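(* Let $W$ be a $p\times p$ weight matrix function on $[a,b]$ with orthonormal matrix polynomials $P_0,P_1,P_2,\dots$ and let $n\ge 1$. Let $(X,J)$ be a Jordan pair of the orthonormal matrix polynomial $P_n(x)$; that is, let $x_1,\dots,x_k$ be the distinct zeros of $P_n$, let $m_i$ be the multiplicity of $x_i$, and let $v_{i,1},\dots,v_{i,m_i}\in\mathbb{R}^p$ be the columns of $X$ associated with $x_i$ (linearly independent non-zero vectors with $P_n(x_i)v_{i,j}=0$). Let $F$ be a $p\times p$ real matrix-valued function (defined at the points $x_i$). Then the interpolation matrix polynomial of the Lagrange interpolation problem, i.e. the matrix polynomial $P(x)=A_{n-1}x^{n-1}+\dots+A_1x+A_0$ with $A_j\in\mathbb{R}^{p\times p}$ satisfying $$P(x_i)\,v_{i,j}=F(x_i)\,v_{i,j},\qquad j=1,\dots,m_i,\quad i=1,\dots,k,$$ is given by $$P(x)=\sum_{i=1}^k F(x_i)\,W_i(x),\qquad W_i(x)=(v_{i,1}\ \cdots\ v_{i,m_i})\,K_i^{-1}\begin{pmatrix} v_{i,1}^T\\ \vdots\\ v_{i,m_i}^T\end{pmatrix}\frac{P_{n+1}(x_i)^TD_{n+1}P_n(x)}{x-x_i},$$ where the $m_i\times m_i$ matrix $K_i$ is $$K_i=-\begin{pmatrix} v_{i,1}^T\\ \vdots\\ v_{i,m_i}^T\end{pmatrix}K_{n-1}(x_i,x_i)\,(v_{i,1}\ \cdots\ v_{i,m_i}),\qquad K_{n-1}(x,y)=\sum_{j=0}^{n-1}P_j(y)^TP_j(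x).$$
   Context: A weight matrix function on $[a,b]$ is a symmetric $p\times p$ real matrix-valued function $W(x)$, integrable over $[a,b]$ (with finite moments), such that $W(x)\ge 0$ (positive semidefinite) and $\det W(x)\ne 0$ almost everywhere on $[a,b]$; it is normalized by $\int_a^bW(x)\,dx=I$. The orthonormal matrix polynomials $P_n(x)$, with coefficients in $\mathbb{R}^{p\times p}$, satisfy $\int_a^bP_n(x)W(x)P_m(x)^T\,dx=\delta_{n,m}I$; $P_n$ has degree $n$ and non-singular leading coefficient, and is determined up to left multiplication by an orthogonal matrix. These orthogonal factors are chosen so that the three-term recurrence $$xP_n(x)=D_{n+1}P_{n+1}(x)+E_nP_n(x)+D_n^TP_{n-1}(x),\quad n\ge 0,\qquad P_{-1}=0,\ P_0=I,$$ holds with all $D_n$ ($n\ge1$) symmetric positive definite and all $E_n$ symmetric. A zero of $P_n$ is a point $x_0$ with $\det P_n(x_0)=0$, and its multiplicity is its multiplicity as a root of the polynomial $\det P_n$ (which has degree $np$, so $\sum_i m_i=np$). The zeros of $P_n$ are real, and all Jordan chains of $P_n$ have length $1$, so a Jordan pair of $P_n$ consists of $J=\mathrm{diag}(x_1,\dots,x_1,\dots,x_k,\dots,x_k)$, each $x_i$ repeated $m_i$ times, and $X=(v_{1,1}\ \cdots\ v_{1,m_1}\ \cdots\ v_{k,1}\ \cdots\ v_{k,m_k})$, where for each $i$ the vectors $v_{i,1},\dots,v_{i,m_i}$ are linearly independent with $P_n(x_i)v_{i,j}=0$; the $np\times np$ matrix obtained by stacking $X,XJ,\dots,XJ^{n-1}$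 vertically is then non-singular. The expression for $W_i(x)$ is a matrix polynomial (the factor $x-x_i$ divides out), and its value at $x=x_i$ is understood accordingly. *)

(* Defs.v *)
From HB Require Import structures.
From mathcomp Require Import all_boot all_order all_algebra.
From mathcomp Require Import all_classical all_reals all_analysis.

Set Implicit Arguments.
Unset Strict Implicit.
Unset Printing Implicit Defensive.

Import Order.TTheory GRing.Theory Num.Theory.

Local Open Scope classical_set_scope.
Local Open Scope ring_scope.

(* Matrix polynomials are matrices with polynomial entries, ['M[{poly R}]_p]:
   unlike [{poly 'M[R]_p}], this makes sense for every [p], and the determinant
   is then a polynomial. *)

Section MatrixPolynomials.
Variables (R : realType) (p : nat).
Implicit Types (A B : 'M[R]_p) (Q : 'M[{poly R}]_p).

Definition mpeval Q (x : R) : 'M[R]_p := map_mx (horner_eval x) Q.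

Definition mpconst A : 'M[{poly R}]_p := map_mx polyC A.

Definition mpcoef Q (j : nat) : 'M[R]_p := map_mx (coefp j) Q.

Definition mpoly_of n (A : 'I_n -> 'M[R]_p) : 'M[{poly R}]_p :=
  \sum_(j < n) 'X^j *: mpconst (A j).

(* Degree exactly [n] with non-singular leading coefficient. *)
Definition regular_of_degree n Q : Prop :=
  (forall j, (n < j)%N -> mpcoef Q j = 0) /\ mpcoef Q n \in unitmx.

Definition possemidefmx A : Prop :=
  A^T = A /\ forall v : 'cV[R]_p, 0 <= (v^T *m A *m v) 0 0.

Definition posdefmx A : Prop :=
  A^T = A /\ forall v : 'cV[R]_p, v != 0 -> 0 < (v^T *m A *m v) 0 0.

Definition mxintegral (a b : R) (M : R -> 'M[R]_p) : 'M[R]_p :=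
  \matrix_(i, j) (\int[lebesgue_measure]_(x in `[a, b]) M x i j).

Record weight_matrix (a b : R) (W : R -> 'M[R]_p) : Prop := WeightMatrix {
  weight_sym : forall x, x \in `[a, b] -> (W x)^T = W x;
  (* [k = 0] is the integrability of [W] itself *)
  weight_moments : forall (k : nat) (i j : 'I_p),
    lebesgue_measure.-integrable `[a, b]
      (EFin \o (fun x : R => x ^+ k * W x i j));
  weight_pos : {ae lebesgue_measure, forall x : R, x \in `[a, b] ->
    possemidefmx (W x) /\ \det (W x) != 0};
  weight_normalized : mxintegral a b W = 1%:M
}.

Record orthonormal_mpolys (a b : R) (W : R -> 'M[R]_p)
    (P : nat -> 'M[{poly R}]_p) : Prop := OrthonormalMpolys {
  orthonormal_degree : forall n, regular_of_degree n (P n);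
  orthonormal_dot : forall n m,
    mxintegral a b (fun x => mpeval (P n) x *m W x *m (mpeval (P m) x)^T)
    = (n == m)%:R%:M
}.

(* [D 0] is never constrained: it only multiplies [P_{-1} = 0]. *)
Record three_term_recurrence (P : nat -> 'M[{poly R}]_p)
    (D E : nat -> 'M[R]_p) : Prop := ThreeTermRecurrence {
  recurrence_init : P 0%N = 1%:M;
  recurrence_posdef : forall n, posdefmx (D n.+1);
  recurrence_sym : forall n, (E n)^T = E n;
  recurrence_step : forall n,
    'X *: P n = mpconst (D n.+1) *m P n.+1 + mpconst (E n) *m P n
                + mpconst (D n)^T *m (if n is n'.+1 then P n' else 0)
}.

(* Jordan pair of a matrix polynomial all of whose Jordan chains have length
   one. The matrix [X] is split into column blocks [submxrow X i], whose columns
   are the vectors v_{i,1}, ..., v_{i,m_i}. *)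
Record jordan_pair Q (k : nat) (x : 'I_k -> R) (m : 'I_k -> nat)
    (X : 'M[R]_(p, \sum_(i < k) m i)) (J : 'M[R]_(\sum_(i < k) m i)) : Prop :=
  JordanPair {
  jordan_distinct : injective x;
  jordan_zeros : forall t, root (\det Q) t <-> exists i, t = x i;
  jordan_multiplicity : forall i, m i = mup (x i) (\det Q);
  jordan_matrix : J = \mxdiag_(i < k) (x i)%:M;
  jordan_free : forall i, row_free (submxrow X i)^T;
  jordan_kernel : forall i, mpeval Q (x i) *m submxrow X i = 0
}.

(* [mpkernel P n x y] is K_{n-1}(x, y). *)
Definition mpkernel (P : nat -> 'M[{poly R}]_p) n (x y : R) : 'M[R]_p :=
  \sum_(j < n) (mpeval (P j) y)^T *m mpeval (P j) x.

(* In the next three definitions [V] is the p x m matrix (v_1 ... v_m) of the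
   vectors attached to the zero [x] of [P n]. *)
Definition Kmx (P : nat -> 'M[{poly R}]_p) n (x : R) m (V : 'M[R]_(p, m))
    : 'M[R]_m :=
  - (V^T *m mpkernel P n x x *m V).

Definition Wnum (P : nat -> 'M[{poly R}]_p) (D : nat -> 'M[R]_p) n (x : R) m
    (V : 'M[R]_(p, m)) : 'M[{poly R}]_p :=
  mpconst (V *m invmx (Kmx P n x V) *m V^T
           *m (mpeval (P n.+1) x)^T *m D n.+1) *m P n.

(* Entrywise polynomial quotient; only the whole product [Wnum], not its factor
   P_{n+1}(x)^T D_{n+1} P_n, is divisible by X - x. *)
Definition Wpoly (P : nat -> 'M[{poly R}]_p) (D : nat -> 'M[R]_p) n (x : R) m
    (V : 'M[R]_(p, m)) : 'M[{poly R}]_p :=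
  map_mx (fun q : {poly R} => q %/ ('X - x%:P) : {poly R}) (Wnum P D n x V).

Definition lagrange_solution n (k : nat) (x : 'I_k -> R) (m : 'I_k -> nat)
    (X : 'M[R]_(p, \sum_(i < k) m i)) (F : R -> 'M[R]_p) Q : Prop :=
  (exists A : 'I_n -> 'M[R]_p, Q = mpoly_of A) /\
  forall (i : 'I_k) (j : 'I_(m i)),
    mpeval Q (x i) *m col j (submxrow X i) = F (x i) *m col j (submxrow X i).

End MatrixPolynomials.

(* Main.v *)
(** Let K(x, y) = sum_(j < n) P_j(y)^T P_j(x). The Christoffel-Darboux formula
    and the recurrence at a zero x_i turn W_i into - V_i K_i^-1 V_i^T K(x, x_i),
    V_i being the matrix of the vectors attached to x_i. Hence x - x_i divides
    the numerator, W_i has degree less than n, and W_i(x_j) V_j is V_j if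
    i = j and 0 otherwise; this gives a solution.
    For uniqueness, expand the rows of a solution of the homogeneous problem in
    the basis P_0, ..., P_(n-1): the coefficient vectors are orthogonal to the
    eigenvectors (P_0(x_i) v; ...; P_(n-1)(x_i) v), v in the span of V_i, of the
    symmetric block Jacobi matrix. If the orthogonal complement of these vectors
    were nonzero, it would contain an eigenvector; the recurrence puts it in the
    same form with v in ker P_n(x_i), which is the span of V_i because
    (x - x_i)^(dim ker P_n(x_i)) divides det P_n. *)

Require Import Defs.
From HB Require Import structures.
From mathcomp Require Import all_boot all_order all_algebra.
From mathcomp Require Import complex zify.
From mathcomp Require Import all_classical all_reals all_analysis.
Set Implicit Arguments.
Unset Strict Implicit.
Unset Printing Implicit Defensive.

Import Order.TTheory GRing.Theory Num.Theory.

Local Open Scope ring_scope.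

(** * Gram matrices and eigenvectors of real symmetric matrices *)

Lemma mulmx_tr_ge0 (R : realDomainType) N (u : 'rV[R]_N) :
  0 <= (u *m u^T) 0 0.
Proof. by rewrite mxE sumr_ge0 // => i _; rewrite mxE -expr2 sqr_ge0. Qed.

Lemma mulmx_tr_eq0 (R : realDomainType) N (u : 'rV[R]_N) :
  (u *m u^T) 0 0 = 0 -> u = 0.
Proof.
rewrite mxE => uu0; apply/rowP => i; rewrite mxE; apply/eqP.
have sq_ge0 j : true -> 0 <= u 0 j * u^T j 0 by rewrite mxE -expr2 sqr_ge0.
have := psumr_eq0P sq_ge0 uu0 (i := i) isT.
by rewrite mxE => /eqP; rewrite mulf_eq0 orbb.
Qed.

(** If v A A^T = 0 then |v A|^2 = 0, so v A = 0, and v = 0 by independence of the rows. *)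
Lemma gram_unitmx (R : realFieldType) M N (A : 'M[R]_(M, N)) :
  row_free A -> A *m A^T \in unitmx.
Proof.
move=> fA; rewrite -row_free_unit; apply: inj_row_free => v vAA.
apply: (row_free_inj fA); rewrite mul0mx; apply: mulmx_tr_eq0.
by rewrite trmx_mul mulmxA -(mulmxA v) vAA mul0mx mxE.
Qed.

(* For a complex eigenvalue a + ib of B, (B - a)^2 + b^2 = (B - a - ib)(B - a + ib)
   is a singular real matrix. *)
Lemma exists_sqr_singular (R : rcfType) d (B : 'M[R]_d) : (0 < d)%N ->
  exists a b : R, exists2 w : 'rV_d, w != 0 &
    w *m ((B - a%:M) *m (B - a%:M) + (b ^+ 2)%:M) = 0.
Proof.
move=> d0; pose f : {rmorphism R -> R[i]} := real_complex R.
have /closed_rootP[l] : size (char_poly (map_mx f B)) != 1%N.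
  by rewrite size_char_poly eqSS -lt0n.
rewrite -eigenvalue_root_char => /eigenvalueP[v vB v0].
exists (complex.Re l), (complex.Im l).
set S := _ + _.
suff /eqP/det0P[w w0 wS] : \det S = 0 by exists w.
apply: (fmorph_inj f); rewrite rmorph0 -det_map_mx; apply/eqP/det0P.
exists v => //.
have -> : map_mx f S = (map_mx f B - l%:M) *m (map_mx f B - (conjc l)%:M).
  rewrite /S map_mxD map_mxM map_mxB !map_scalar_mx; case: l vB {S} => a b vB /=.
  pose c : R[i] := complex.Complex 0 b.
  have -> : complex.Complex a b = f a + c by apply/eqP; rewrite eq_complex /= addr0 add0r !eqxx.
  have -> : complex.Complex a (- b) = f a - c.
    by apply/eqP; rewrite eq_complex /= subr0 add0r !eqxx.
  have -> : f (b ^+ 2) = - (c * c).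
    by apply/eqP; rewrite eq_complex /= !(mul0r, mulr0) sub0r addr0 opprK expr2 oppr0 !eqxx.
  set A := map_mx f B - (f a)%:M.
  have -> : map_mx f B - (f a + c)%:M = A - c%:M by rewrite [(f a + c)%:M]raddfD opprD addrA.
  have -> : map_mx f B - (f a - c)%:M = A + c%:M.
    by rewrite [(f a - c)%:M]raddfB opprB addrA addrAC.
  clearbody A; rewrite mulmxDr !mulmxBl -[c%:M *m A]scalar_mxC.
  by rewrite addrA subrK -scalar_mxM -raddfN.
by rewrite mulmxA [v *m _]mulmxBr vB mul_mx_scalar subrr mul0mx.
Qed.

(* On U, A has a vector u with u (A - a)^2 = - b^2 u; as A - a is symmetric, the
   squared norm of u (A - a) is - b^2 |u|^2, so it vanishes. *)
Lemma sym_stable_eigenvector (R : rcfType) N (A U : 'M[R]_N) :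
  A^T = A -> stablemx U A -> U != 0 ->
  exists l (u : 'rV_N), [/\ u != 0, (u <= U)%MS & u *m A = l *: u].
Proof.
move=> symA UA U0.
pose V := row_base U; have fV : row_free V := row_base_free U.
(* [B] represents the restriction of [A] to U in a basis that need not be orthonormal, so [B] itself
   need not be symmetric. *)
have [B VA] : exists B, V *m A = B *m V.
  by apply/submxP; rewrite -/(stablemx V A) stablemx_row_base.
have d0 : (0 < \rank U)%N by rewrite lt0n mxrank_eq0.
have [a [b [w w0 wB]]] := exists_sqr_singular B d0.
pose C := A - a%:M; pose u := w *m V.
have VC : V *m C = (B - a%:M) *m V.
  by rewrite mulmxBr mulmxBl VA scalar_mxC.
have uC : u *m C *m C = - b ^+ 2 *: u.
  have VCC : V *m C *m C = (B - a%:M) *m (B - a%:M) *m V.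
    by rewrite VC -mulmxA VC mulmxA.
  apply/eqP; rewrite scaleNr -addr_eq0 -mul_scalar_mx -scalar_mxC /u.
  by rewrite -!(mulmxA w) VCC -mulmxDr scalar_mxC -mulmxDl mulmxA wB mul0mx.
have symC : C^T = C by rewrite linearB /= symA tr_scalar_mx.
exists a, u; split.
- by apply: contra_neq w0 => u0; apply: (row_free_inj fV); rewrite mul0mx.
- by rewrite -(eq_row_base U) submxMl.
apply/eqP; rewrite -subr_eq0 -mul_mx_scalar -mulmxBr; apply/eqP.
apply: mulmx_tr_eq0; apply/le_anti; rewrite mulmx_tr_ge0 andbT.
rewrite trmx_mul symC mulmxA uC -scalemxAl mxE mulNr oppr_le0.
by rewrite mulr_ge0 ?sqr_ge0 ?mulmx_tr_ge0.
Qed.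

(** * Kernel dimension and multiplicity of a zero of the determinant *)

(** Each of the first r columns yields one factor X - x, collected in a diagonal matrix. *)
Lemma XsubC_dvdp_det (F : fieldType) p r (Q : 'M[{poly F}]_p) (x : F) :
  (forall (i j : 'I_p), (j < r)%N -> root (Q i j) x) -> (r <= p)%N ->
  ('X - x%:P) ^+ r %| \det Q.
Proof.
move=> rQ rp.
pose d : 'rV_p := \row_j (if (j < r)%N then 'X - x%:P else 1).
pose G := \matrix_(i, j) (if (j < r)%N then Q i j %/ ('X - x%:P) else Q i j).
have -> : Q = G *m diag_mx d.
  apply/matrixP => i j; rewrite mul_mx_diag !mxE; case: ifP => jr; last by rewrite mulr1.
  by rewrite divpK // dvdp_XsubCl; apply: rQ.
rewrite det_mulmx det_diag dvdp_mull //.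
have -> : \prod_i d 0 i = ('X - x%:P) ^+ #|[pred i : 'I_p | (i < r)%N]|.
  by rewrite -prodr_const [RHS]big_mkcond /=; apply: eq_bigr => i _; rewrite mxE.
suff -> : #|[pred i : 'I_p | (i < r)%N]| = r by [].
by rewrite -sum1_card (big_ord_narrow rp) sum1_card card_ord.
Qed.

(** Invertible constant column operations move the kernel vectors to the first r coordinates, so
    that r columns vanish at x; the determinant changes only by a nonzero constant. *)
Lemma rank_le_mup_det (F : fieldType) p r (Q : 'M[{poly F}]_p) (x : F)
    (V : 'M[F]_(r, p)) : \det Q != 0 -> row_free V ->
  map_mx (horner_eval x) Q *m V^T = 0 -> (r <= mup x (\det Q))%N.
Proof.
move=> Q0 fV QV; rewrite mup_geq //.
have rp : (r <= p)%N by rewrite -(eqP fV) rank_leq_col.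
(* [V] is an invertible matrix times the first r rows of [L], so Q(x) kills the first r columns of
   [L^T]. *)
pose L := row_ebase V; pose M := Q *m map_mx polyC L^T.
have detL : \det (map_mx polyC L^T) != 0.
  rewrite det_map_mx polyC_eq0 det_tr -unitfE -unitmxE.
  exact: row_ebase_unit.
have Mx : map_mx (horner_eval x) M *m pid_mx r = 0 :> 'M[F]_p.
  rewrite map_mxM -map_mx_comp [map_mx _ L^T]map_mx_id; last first.
    by move=> c /=; rewrite /horner_eval hornerC.
  have LV : (pid_mx r : 'M[F]_(r, p)) *m L = invmx (col_ebase V) *m V.
    have := congr1 (mulmx (invmx (col_ebase V))) (mulmx_ebase V).
    by rewrite (eqP fV) -!mulmxA mulKmx ?col_ebase_unit.
  have -> : pid_mx r = ((pid_mx r : 'M[F]_(p, r)) *m (pid_mx r : 'M[F]_(r, p)))^T.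
    by rewrite pid_mx_id // tr_pid_mx.
  by rewrite -mulmxA -trmx_mul -mulmxA LV !trmx_mul !mulmxA QV !mul0mx.
suff : ('X - x%:P) ^+ r %| \det M.
  by move: detL; rewrite det_mulmx det_map_mx polyC_eq0 mulrC mul_polyC => /dvdpZr->.
apply: XsubC_dvdp_det => // i j jr.
move/matrixP/(_ i j): Mx; rewrite !mxE (bigD1 j) //= big1 => [|l /negPf lj].
  by rewrite !mxE eqxx jr mulr1 addr0 => /rootP.
by rewrite !mxE (inj_eq val_inj) lj mulr0.
Qed.

(** * Evaluation, coefficients and bases of matrix polynomials *)

Lemma mpevalM (R : realType) p (x : R) (A B : 'M[{poly R}]_p) :
  mpeval (A *m B) x = mpeval A x *m mpeval B x.
Proof. exact: map_mxM. Qed.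

Lemma mpevalD (R : realType) p (x : R) (A B : 'M[{poly R}]_p) :
  mpeval (A + B) x = mpeval A x + mpeval B x.
Proof. exact: map_mxD. Qed.

Lemma mpevalZ (R : realType) p (x : R) (q : {poly R}) (A : 'M[{poly R}]_p) :
  mpeval (q *: A) x = q.[x] *: mpeval A x.
Proof. exact: map_mxZ. Qed.

Lemma mpeval_sum (R : realType) p (x : R) n (A : 'I_n -> 'M[{poly R}]_p) :
  mpeval (\sum_i A i) x = \sum_i mpeval (A i) x.
Proof. exact: raddf_sum. Qed.

Lemma mpevalC (R : realType) p (x : R) (A : 'M[R]_p) : mpeval (mpconst A) x = A.
Proof. by apply/matrixP => i j; rewrite !mxE /horner_eval hornerC. Qed.

Lemma mpconstM (R : realType) p (A B : 'M[R]_p) :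
  mpconst (A *m B) = mpconst A *m mpconst B.
Proof. exact: map_mxM. Qed.

Lemma mpcoefCM (R : realType) p (A : 'M[R]_p) (Q : 'M[{poly R}]_p) j :
  mpcoef (mpconst A *m Q) j = A *m mpcoef Q j.
Proof.
apply/matrixP => i l; rewrite !mxE /= coef_sum; apply: eq_bigr => s _.
by rewrite !mxE coefCM.
Qed.

Lemma mpcoef_sum (R : realType) p j n (A : 'I_n -> 'M[{poly R}]_p) :
  mpcoef (\sum_i A i) j = \sum_i mpcoef (A i) j.
Proof. exact: raddf_sum. Qed.

Lemma mpoly_ofP (R : realType) p n (Q : 'M[{poly R}]_p) :
  (exists A : 'I_n -> 'M[R]_p, Q = mpoly_of A) <->
  (forall j, (n <= j)%N -> mpcoef Q j = 0).
Proof.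
have coef_mono (A : 'M[R]_p) i j : mpcoef ('X^i *: mpconst A) j = (j == i)%:R *: A.
  by apply/matrixP => s t; rewrite !mxE /= coefMC coefXn.
split=> [[A ->] j nj | Q0].
  rewrite mpcoef_sum big1 // => i _; rewrite coef_mono gtn_eqF ?scale0r //.
  exact: leq_trans (ltn_ord i) nj.
exists (fun i => mpcoef Q i); apply/matrixP => s t; apply/polyP => j.
have entry (M : 'M[{poly R}]_p) : (M s t)`_j = mpcoef M j s t by rewrite mxE.
rewrite !entry; congr (fun_of_matrix _ s t).
rewrite mpcoef_sum; under eq_bigr do rewrite coef_mono.
have [jn | nj] := ltnP j n.
  rewrite (bigD1 (Ordinal jn)) //= eqxx scale1r big1 ?addr0 // => i.
  by rewrite -val_eqE eq_sym /= => /negPf->; rewrite scale0r.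
rewrite Q0 // big1 // => i _; rewrite gtn_eqF ?scale0r //.
exact: leq_trans (ltn_ord i) nj.
Qed.

(** The leading coefficient of P_n is invertible, so a left multiple of P_n removes the term of
    degree n, and induction does the rest. *)
Lemma regular_basis (R : realType) p (P : nat -> 'M[{poly R}]_p) n
    (Q : 'M[{poly R}]_p) : (forall i, regular_of_degree i (P i)) ->
  (forall j, (n <= j)%N -> mpcoef Q j = 0) ->
  exists C : nat -> 'M[R]_p, Q = \sum_(j < n) mpconst (C j) *m P j.
Proof.
move=> regP; elim: n Q => [|n IHn] Q Q0.
  exists (fun=> 0); rewrite big_ord0; apply/matrixP => s t; apply/polyP => j.
  by have /matrixP/(_ s t) := Q0 j isT; rewrite !mxE coef0.
pose B := mpcoef Q n *m invmx (mpcoef (P n) n).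
have [P0 uP] := regP n.
have [j nj | C QC] := IHn (Q - mpconst B *m P n).
  rewrite /mpcoef map_mxB -!/(mpcoef _ _) mpcoefCM.
  move: nj; rewrite leq_eqVlt => /predU1P[<- | nj]; first by rewrite mulmxKV ?subrr.
  by rewrite Q0 // P0 // mulmx0 subr0.
exists (fun j => if j == n then B else C j); rewrite big_ord_recr /= eqxx.
rewrite -[LHS](subrK (mpconst B *m P n)) QC; congr (_ + _).
by apply: eq_bigr => i _; rewrite ltn_eqF.
Qed.

(** * The kernel, the Christoffel-Darboux formula and the form of W_i *)

(** The convention P_{-1} = 0, for any sequence in a group: it serves both for polynomials and for
    the blocks of a vector. *)
Definition prev (V : zmodType) (P : nat -> V) (n : nat) : V :=
  if n is n'.+1 then P n' else 0.

(* K_{n-1}(x, y) as a polynomial in its first argument. *)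
Definition kernel_mpoly (R : realType) p (P : nat -> 'M[{poly R}]_p) n (y : R) :
    'M[{poly R}]_p := \sum_(j < n) mpconst (mpeval (P j) y)^T *m P j.

Lemma mpeval_kernel (R : realType) p (P : nat -> 'M[{poly R}]_p) n (x y : R) :
  mpeval (kernel_mpoly P n y) x = mpkernel P n x y.
Proof. by rewrite mpeval_sum; apply: eq_bigr => j _; rewrite mpevalM mpevalC. Qed.

Lemma mpcoef_kernel (R : realType) p (P : nat -> 'M[{poly R}]_p) n (y : R) j :
  (forall i, regular_of_degree i (P i)) -> (n <= j)%N ->
  mpcoef (kernel_mpoly P n y) j = 0.
Proof.
move=> regP nj; rewrite mpcoef_sum big1 // => i _; have [P0 _] := regP i.
by rewrite mpcoefCM P0 ?mulmx0 // (leq_trans (ltn_ord i)).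
Qed.

Lemma recurrence_eval (R : realType) p (P : nat -> 'M[{poly R}]_p) D E n (y : R) :
  three_term_recurrence P D E ->
  y *: mpeval (P n) y = D n.+1 *m mpeval (P n.+1) y + E n *m mpeval (P n) y
    + (D n)^T *m mpeval (prev P n) y.
Proof.
case=> _ _ _ rec; have /(congr1 (fun M => mpeval M y)) := rec n.
by rewrite mpevalZ hornerX !mpevalD !mpevalM !mpevalC.
Qed.

(** Induction on n: in (X - y) P_n(y)^T P_n the recurrence rewrites X P_n and y P_n(y); the E_n
    terms cancel by symmetry and the rest telescopes. [(D n)^T] stays transposed because [D 0] is
    arbitrary. *)
Lemma Christoffel_Darboux (R : realType) p (P : nat -> 'M[{poly R}]_p) D E n
    (y : R) : three_term_recurrence P D E ->
  ('X - y%:P) *: kernel_mpoly P n y =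
  mpconst ((mpeval (prev P n) y)^T *m D n) *m P n
  - mpconst ((mpeval (P n) y)^T *m (D n)^T) *m prev P n.
Proof.
move=> recP; have [_ _ symE rec] := recP; elim: n => [|n IHn].
  rewrite /kernel_mpoly big_ord0 scaler0 /= mulmx0 subr0.
  by rewrite /mpeval map_mx0 trmx0 mul0mx /mpconst map_mx0 mul0mx.
rewrite /kernel_mpoly big_ord_recr /= scalerDr IHn.
rewrite [X in _ + X]scalerBl ['X *: (_ *m _)]scalemxAr rec.
have -> : y%:P *: (mpconst (mpeval (P n) y)^T *m P n) =
    mpconst (y *: mpeval (P n) y)^T *m P n.
  by rewrite scalemxAl; congr (_ *m _); apply/matrixP => i j; rewrite !mxE polyCM.
have -> : (y *: mpeval (P n) y)^T = (mpeval (P n.+1) y)^T *m (D n.+1)^T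
    + (mpeval (P n) y)^T *m E n + (mpeval (prev P n) y)^T *m D n.
  by rewrite (recurrence_eval n y recP) !linearD /= !trmx_mul symE trmxK.
rewrite -/(prev P n) /mpconst !map_mxD -!/(mpconst _) !mulmxDl !mulmxDr !mpconstM.
rewrite !mulmxA.
have cancel (V : zmodType) (u v c d e : V) :
    u - v + (c + e + v - (d + e + u)) = c - d.
  rewrite [c + e + v]addrC [d + e + u]addrC addrA subrKA opprD addrACA subrr add0r.
  by rewrite opprD addrACA subrr addr0.
exact: cancel.
Qed.

Lemma Wnum_kernel (R : realType) p (P : nat -> 'M[{poly R}]_p) D E n m (y : R)
    (V : 'M[R]_(p, m)) : three_term_recurrence P D E ->
    mpeval (P n) y *m V = 0 ->
  Wnum P D n y V =
  ('X - y%:P) *: (- (mpconst (V *m invmx (Kmx P n y V) *m V^T) *m kernel_mpoly P n y)).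
Proof.
move=> recP PV.
have symD : (D n.+1)^T = D n.+1 by have [_ pD _ _] := recP; case: (pD n).
(* The recurrence at y, applied to [V] and transposed: both terms in P_n(y) vanish. *)
have rec : V^T *m (mpeval (P n.+1) y)^T *m D n.+1 =
    - (V^T *m (mpeval (prev P n) y)^T *m D n).
  have /(congr1 (fun M => (M *m V)^T)) := recurrence_eval n y recP.
  rewrite -scalemxAl PV scaler0 !mulmxDl -!mulmxA PV mulmx0 addr0 !mulmxA.
  rewrite linearD /= !trmx_mul symD trmxK !mulmxA trmx0 => /esym/eqP.
  by rewrite addr_eq0 => /eqP.
have zV : V^T *m (mpeval (P n) y)^T = 0 by rewrite -trmx_mul PV trmx0.
(* Left multiplication by V^T kills the second Christoffel-Darboux term; [rec] turns the first into
   the numerator, up to sign. *)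
rewrite scalerN scalemxAr (Christoffel_Darboux n y recP) mulmxBr.
rewrite !(mulmxA (mpconst (V *m _ *m _))) -!mpconstM.
set C := V *m invmx _.
have -> : C *m V^T *m ((mpeval (P n) y)^T *m (D n)^T) = 0.
  by rewrite mulmxA -(mulmxA C) zV mulmx0 mul0mx.
rewrite /Wnum -/C -(mulmxA C V^T (_ *m _)) (mulmxA V^T) -[_ *m D n]opprK -rec.
rewrite -!(mulmxA C) mulmxN /mpconst map_mx0 mul0mx subr0.
by rewrite map_mxN mulNmx opprK.
Qed.

Lemma WpolyE (R : realType) p (P : nat -> 'M[{poly R}]_p) D E n m (y : R)
    (V : 'M[R]_(p, m)) : three_term_recurrence P D E ->
    mpeval (P n) y *m V = 0 ->
  Wpoly P D n y V =
  - (mpconst (V *m invmx (Kmx P n y V) *m V^T) *m kernel_mpoly P n y).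
Proof.
move=> recP PV; apply/matrixP => i j; rewrite mxE (Wnum_kernel recP PV) [X in X %/ _]mxE.
by rewrite mulKp // polyXsubC_eq0.
Qed.

(** Between V^T and U both terms on the right of Christoffel-Darboux vanish, and x - y can be
    cancelled. *)
Lemma kernel_orthogonal (R : realType) p (P : nat -> 'M[{poly R}]_p) D E n m1 m2
    (x y : R) (V : 'M[R]_(p, m1)) (U : 'M[R]_(p, m2)) :
    three_term_recurrence P D E -> x != y ->
    mpeval (P n) x *m U = 0 -> mpeval (P n) y *m V = 0 ->
  V^T *m mpkernel P n x y *m U = 0.
Proof.
move=> recP xy PU PV.
have zV : V^T *m (mpeval (P n) y)^T = 0 by rewrite -trmx_mul PV trmx0.
have := congr1 (fun M => V^T *m mpeval M x *m U) (Christoffel_Darboux n y recP).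
rewrite mpevalZ mpeval_kernel hornerXsubC -scalemxAr -scalemxAl.
rewrite /mpeval map_mxB -!/(mpeval _ _) !mpevalM !mpevalC mulmxBr mulmxBl.
rewrite -!mulmxA PU !mulmx0 sub0r !(mulmxA V^T) zV !mul0mx oppr0 => /eqP.
by rewrite scaler_eq0 subr_eq0 (negPf xy) => /eqP; rewrite -!mulmxA.
Qed.

(** * Stacked values of the P_j and the block Jacobi matrix *)

Definition mpcol (R : realType) p (P : nat -> 'M[{poly R}]_p) n (x : R) :
    'M[R]_(\sum_(j < n) p, p) := \mxcol_(j < n) mpeval (P j) x.

Lemma mpkernel_mpcol (R : realType) p (P : nat -> 'M[{poly R}]_p) n (x y : R) :
  mpkernel P n x y = (mpcol P n y)^T *m mpcol P n x.
Proof. by rewrite tr_mxcol mul_mxrow_mxcol. Qed.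

(** The first block is P_0 = I; it is present because n > 0. *)
Lemma mpcol_inj (R : realType) p (P : nat -> 'M[{poly R}]_p) n m (x : R)
    (U : 'M[R]_(p, m)) : (0 < n)%N -> P 0%N = 1%:M ->
  mpcol P n x *m U = 0 -> U = 0.
Proof.
case: n => // n _ P0; rewrite mxcol_mul.
have <- : \mxcol_(j < n.+1) (0 : 'M[R]_(p, m)) = 0 by exact: mxcol0.
move/eq_mxcolP/(_ ord0) => /=.
by rewrite P0 /mpeval map_mx1 mul1mx.
Qed.

(** Up to sign this is the Gram matrix of the columns of [mpcol P n x *m V], which are
    independent. *)
Lemma Kmx_unit (R : realType) p (P : nat -> 'M[{poly R}]_p) n m (x : R)
    (V : 'M[R]_(p, m)) : (0 < n)%N -> P 0%N = 1%:M -> row_free V^T ->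
  Kmx P n x V \in unitmx.
Proof.
move=> n0 P0 fV; rewrite unitmxE /Kmx -scaleN1r detZ unitrM unitrX ?unitrN1 //=.
have -> : V^T *m mpkernel P n x x *m V = (mpcol P n x *m V)^T *m (mpcol P n x *m V)^T^T.
  by rewrite mpkernel_mpcol trmxK trmx_mul !mulmxA.
rewrite -unitmxE; apply: gram_unitmx; apply: inj_row_free => v /(congr1 trmx).
rewrite trmx_mul trmxK trmx0 -mulmxA => /(mpcol_inj n0 P0) /(congr1 trmx).
by rewrite trmx_mul trmxK trmx0 => vV; apply: (row_free_inj fV); rewrite mul0mx.
Qed.

(** Block tridiagonal matrix of the recurrence cut off at n. Row i carries D_{i+1} to the right of
    E_i and D_i^T to its left, so [D 0] never occurs. *)
Definition jacobi_mx (R : realType) p (D E : nat -> 'M[R]_p) n :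
    'M[R]_(\sum_(j < n) p) :=
  \mxblock_(i < n, j < n)
    if i == j :> nat then E i else if i.+1 == j then D j
    else if j.+1 == i then (D i)^T else 0.

Lemma posdefmx_unit (R : realType) p (A : 'M[R]_p) : posdefmx A -> A \in unitmx.
Proof.
case=> symA pA; rewrite -row_free_unit; apply: inj_row_free => v vA.
apply/eqP/contraT => v0; have := pA v^T; rewrite trmx_eq0 trmxK vA mul0mx mxE ltxx.
by move/(_ v0).
Qed.

Lemma tr_jacobi_mx (R : realType) p (P : nat -> 'M[{poly R}]_p) D E n :
  three_term_recurrence P D E -> (jacobi_mx D E n)^T = jacobi_mx D E n.
Proof.
case=> _ pD symE _.
have symD j : (D j.+1)^T = D j.+1 by case: (pD j).
rewrite tr_mxblock; apply/eq_mxblockP => i j; rewrite [j == i :> nat]eq_sym.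
have [-> /= | _] := eqVneq (i : nat) j; first by rewrite symE.
have [<- | _] := eqVneq j.+1 (i : nat).
  by rewrite ifF ?symD //; apply/negP => /eqP; lia.
by case: eqVneq => [<- | _]; rewrite ?symD ?trmx0.
Qed.

(** Indexing the blocks by all naturals gives every row the same form: [w n = 0] accounts for the
    cut in the last row, [prev] for the first. *)
Lemma jacobi_mulE (R : realType) p (D E : nat -> 'M[R]_p) n m
    (w : nat -> 'M[R]_(p, m)) : w n = 0 ->
  jacobi_mx D E n *m \mxcol_(j < n) w j =
  \mxcol_(j < n) (D j.+1 *m w j.+1 + E j *m w j + (D j)^T *m prev w j).
Proof.
move=> wn0; rewrite mul_mxblock_mxrow; apply/eq_mxcolP => i.
have pick (a : nat) (h : nat -> 'M[R]_(p, m)) :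
    \sum_(j < n) (if a == j :> nat then h j else 0) = if (a < n)%N then h a else 0.
  by rewrite -big_mkcond -(big_ord1_eq +%R h a n); apply: eq_bigl => j; rewrite eq_sym.
(* Superdiagonal, diagonal and subdiagonal are separated, so that [pick] evaluates each sum. *)
transitivity (\sum_(j < n) ((if i.+1 == j then D j *m w j else 0)
    + (if i == j :> nat then E i *m w j else 0)
    + (if (i : nat) == j.+1 then (D i)^T *m prev w i else 0))).
  apply: eq_bigr => j _; have [ij | ij] := eqVneq (i : nat) j.
    rewrite ifF ?add0r; last by apply/eqP; lia.
    by rewrite ifF ?addr0 //; apply/eqP; lia.
  have [ij1 | _] := eqVneq i.+1 (j : nat).
    by rewrite !addr0 ifF ?addr0 //; apply/eqP; lia.
  rewrite !add0r [in LHS]eq_sym; case: eqP => [-> // | _]; by rewrite mul0mx.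
rewrite !big_split /= (pick i.+1 (fun j => D j *m w j)).
rewrite (pick i (fun j => E i *m w j)) ltn_ord; congr (_ + _ + _).
  case: ltnP => // ni; suff -> : i.+1 = n by rewrite wn0 mulmx0.
  by apply/eqP; rewrite eqn_leq ni ltn_ord.
case: (i : nat) (ltn_ord i) => [|i'] i'n; first by rewrite mulmx0 big1.
have := pick i' (fun=> (D i'.+1)^T *m w i').
by rewrite (ltn_trans (ltnSn _) i'n).
Qed.

Lemma scale_mxcol (R : pzRingType) k (d : 'I_k -> nat) m (a : R)
    (C : forall i, 'M[R]_(d i, m)) :
  a *: \mxcol_i C i = \mxcol_i (a *: C i).
Proof. by apply/matrixP => i j; rewrite !mxE. Qed.

Lemma jacobi_mpcol (R : realType) p (P : nat -> 'M[{poly R}]_p) D E n m (x : R)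
    (V : 'M[R]_(p, m)) : three_term_recurrence P D E ->
    mpeval (P n) x *m V = 0 ->
  jacobi_mx D E n *m (mpcol P n x *m V) = x *: (mpcol P n x *m V).
Proof.
move=> recP PV; rewrite !mxcol_mul scale_mxcol.
rewrite (@jacobi_mulE _ _ D E n m (fun j => mpeval (P j) x *m V) PV).
apply/eq_mxcolP => j; rewrite scalemxAl (recurrence_eval j x recP) !mulmxDl !mulmxA.
by case: (j : nat) => [|i] /=; rewrite -?mulmxA // /mpeval map_mx0 mul0mx.
Qed.

(** Since D_{j+1} is invertible, the first block w determines the others as P_j(x) w; the boundary
    value 0 at index n then says P_n(x) w = 0. *)
Lemma jacobi_eigenvector (R : realType) p (P : nat -> 'M[{poly R}]_p) D E n m (x : R)
    (u : 'M[R]_(\sum_(j < n) p, m)) : three_term_recurrence P D E ->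
    jacobi_mx D E n *m u = x *: u ->
  exists2 w : 'M[R]_(p, m), mpeval (P n) x *m w = 0 & u = mpcol P n x *m w.
Proof.
move=> recP Ju.
(* The blocks of [u], extended by 0 from index n on. *)
pose w j := if insub j is Some i then submxcol u i else 0 : 'M[R]_(p, m).
have wn j : (n <= j)%N -> w j = 0 by move=> nj; rewrite /w insubF // ltnNge nj.
have wE : u = \mxcol_(j < n) w j.
  by rewrite -[LHS]submxcolK; apply/eq_mxcolP => j; rewrite /w valK.
have rec j : (j < n)%N ->
    x *: w j = D j.+1 *m w j.+1 + E j *m w j + (D j)^T *m prev w j.
  move=> jn; move: Ju; rewrite wE (jacobi_mulE D E (wn n (leqnn n))) scale_mxcol.
  by move=> /eq_mxcolP/(_ (Ordinal jn)).
have [P0 pD _ _] := recP.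
have wP j : (j <= n)%N -> w j = mpeval (P j) x *m w 0%N.
  elim/ltn_ind: j => -[|j] IH jn; first by rewrite P0 /mpeval map_mx1 mul1mx.
  have uD := posdefmx_unit (pD j).
  have prevE : prev w j = mpeval (prev P j) x *m w 0%N.
    case: j IH jn {uD} => [|j] IH jn; last by apply: IH; lia.
    by rewrite /mpeval map_mx0 mul0mx.
  apply: (can_inj (mulKmx uD)).
  have := rec j jn; rewrite (IH j (ltnSn j) (ltnW jn)) prevE scalemxAl.
  rewrite (recurrence_eval _ _ recP).
  by rewrite !mulmxDl !mulmxA => /addIr/addIr.
exists (w 0%N); first by rewrite -wP ?wn.
by rewrite {1}wE mxcol_mul; apply/eq_mxcolP => j; rewrite wP // ltnW.
Qed.

(** * Completeness of the Jordan vectors and uniqueness *)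

(** The span of the m_i independent vectors lies in the kernel of Q(x_i), whose dimension is at most
    the multiplicity m_i; so the two coincide. *)
Lemma kernel_sub_jordan (R : realType) p (Q : 'M[{poly R}]_p) k (x : 'I_k -> R)
    (m : 'I_k -> nat) (X : 'M[R]_(p, \sum_(i < k) m i)) J i q (w : 'M[R]_(p, q)) :
    jordan_pair Q x X J -> mpeval Q (x i) *m w = 0 ->
  exists z, w = submxrow X i *m z.
Proof.
move=> [_ zerosQ mE _ freeX kerX] Qw.
(* Otherwise every real is one of the k points x_i, yet 0, ..., k are k + 1 distinct reals. *)
have Q0 : \det Q != 0.
  apply/eqP => detQ0; have root_all t : exists i, t = x i.
    by apply/zerosQ; rewrite detQ0 root0.
  have : (size [seq j%:R : R | j <- iota 0 k.+1] <= size [seq x j | j <- enum 'I_k])%N.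
    apply: uniq_leq_size => [|_ /mapP[j _ ->]].
      by rewrite map_inj_uniq ?iota_uniq // => a b /eqP; rewrite eqr_nat => /eqP.
    by have [l ->] := root_all j%:R; apply: map_f; rewrite mem_enum.
  by rewrite size_map size_iota size_map size_enum_ord ltnn.
set V := submxrow X i; pose K := kermx (mpeval Q (x i))^T.
have VK : (V^T <= K)%MS by apply/sub_kermxP; rewrite -trmx_mul kerX trmx0.
have KV : (K <= V^T)%MS.
  rewrite -(geq_leqif (mxrank_leqif_sup VK)) (eqP (freeX i)) mE.
  apply: (rank_le_mup_det Q0 (row_base_free K)).
  apply: trmx_inj; rewrite trmx_mul trmxK trmx0; apply/sub_kermxP.
  by rewrite eq_row_base.
have : (w^T <= V^T)%MS.
  by apply: submx_trans KV; apply/sub_kermxP; rewrite -trmx_mul Qw trmx0.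
by case/submxP => z wz; exists z^T; rewrite -[w]trmxK wz trmx_mul trmxK.
Qed.

Lemma mpcol_jordan_complete (R : realType) p (P : nat -> 'M[{poly R}]_p) D E n k
    (x : 'I_k -> R) (m : 'I_k -> nat) (X : 'M[R]_(p, \sum_(i < k) m i)) J q
    (C : 'M[R]_(q, \sum_(j < n) p)) :
    three_term_recurrence P D E -> (0 < n)%N -> jordan_pair (P n) x X J ->
    (forall i, C *m (mpcol P n (x i) *m submxrow X i) = 0) ->
  C = 0.
Proof.
move=> recP n0 jP C0; have symJ := tr_jacobi_mx n recP.
have [_ zerosP _ _ _ kerX] := jP.
pose Y := \mxrow_i (mpcol P n (x i) *m submxrow X i).
pose T := jacobi_mx D E n.
have YP r (B : 'M[R]_(r, \sum_(j < n) p)) : (forall i,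
    B *m (mpcol P n (x i) *m submxrow X i) = 0) <-> B *m Y = 0.
  rewrite mul_mxrow; split=> [B0 | BY i].
    by rewrite -[RHS](mxrow0 (q_ := m)); apply/eq_mxrowP => i; rewrite B0.
  by have := congr1 (fun M => submxrow M i) BY; rewrite mxrowK submxrow0.
(* The columns of [Y] are eigenvectors of [T], so the row vectors annihilating them form a stable
   space. *)
have KT : stablemx (kermx Y) T.
  apply/sub_kermxP/YP => i; rewrite -mulmxA jacobi_mpcol // -scalemxAr.
  by rewrite (YP _ (kermx Y)).2 ?scaler0 // mulmx_ker.
suff K0 : kermx Y = 0.
  by apply/eqP; rewrite -submx0 -K0; apply/sub_kermxP/YP.
apply/eqP/contraT => K0.
have [l [u [u0 uK uT]]] := sym_stable_eigenvector symJ KT K0.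
have Tu : T *m u^T = l *: u^T by rewrite -[T]symJ -trmx_mul uT linearZ.
have [w Pw uw] := jacobi_eigenvector recP Tu.
have w0 : w != 0.
  by apply: contra_neq u0 => w0; rewrite -[u]trmxK uw w0 mulmx0 trmx0.
have [i li] : exists i, l = x i.
  apply/zerosP; rewrite rootE; apply/eqP.
  rewrite -[_.[l]]/(horner_eval l _) -det_map_mx -det_tr; apply/eqP/det0P.
  by exists w^T; rewrite ?trmx_eq0 // -trmx_mul Pw trmx0.
rewrite li in Pw uw.
have [z wz] := kernel_sub_jordan jP Pw.
(* [u^T] lies in the column span of [Y], which [u] annihilates: u is orthogonal to itself. *)
suff : u = 0 by move/eqP; rewrite (negPf u0).
apply: mulmx_tr_eq0; rewrite uw wz (mulmxA (mpcol _ _ _)) mulmxA.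
by rewrite (YP _ u).2 ?mul0mx ?mxE //; apply/sub_kermxP.
Qed.

(** With Q = sum C_j P_j, the value Q(t) is the row of the C_j times [mpcol P n t], so completeness
    forces every C_j to vanish. *)
Lemma lagrange_unique (R : realType) p (P : nat -> 'M[{poly R}]_p) D E n k
    (x : 'I_k -> R) (m : 'I_k -> nat) (X : 'M[R]_(p, \sum_(i < k) m i)) J
    (Q : 'M[{poly R}]_p) :
    (forall j, regular_of_degree j (P j)) -> three_term_recurrence P D E ->
    (0 < n)%N -> jordan_pair (P n) x X J ->
    (forall j, (n <= j)%N -> mpcoef Q j = 0) ->
    (forall i, mpeval Q (x i) *m submxrow X i = 0) ->
  Q = 0.
Proof.
move=> regP recP n0 jP degQ Q0; have [C QC] := regular_basis regP degQ.
have evalQ t : mpeval Q t = \mxrow_(j < n) C j *m mpcol P n t.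
  rewrite QC mpeval_sum mul_mxrow_mxcol; apply: eq_bigr => j _.
  by rewrite mpevalM mpevalC.
have C0 : \mxrow_(j < n) C j = 0.
  by apply: (mpcol_jordan_complete recP n0 jP) => i; rewrite mulmxA -evalQ Q0.
rewrite QC big1 // => j _; have := congr1 (fun M => submxrow M j) C0.
by rewrite mxrowK submxrow0 => ->; rewrite /mpconst map_mx0 mul0mx.
Qed.

(** * The interpolation formula *)

(** The first two clauses ensure that [invmx], which returns a singular matrix unchanged, and [%/],
    which drops remainders, have their intended meaning in W_i. *)
Theorem theorem4p4 (R : realType) (p : nat) (a b : R) (W : R -> 'M[R]_p)
    (P : nat -> 'M[{poly R}]_p) (D E : nat -> 'M[R]_p)
    (n k : nat) (x : 'I_k -> R) (m : 'I_k -> nat)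
    (X : 'M[R]_(p, (\sum_(i < k) m i)%N)) (J : 'M[R]_((\sum_(i < k) m i)%N))
    (F : R -> 'M[R]_p)
    (hp : (0 < p)%N) (hab : a < b) (hW : weight_matrix a b W)
    (hP : orthonormal_mpolys a b W P) (hD : three_term_recurrence P D E)
    (hn : (0 < n)%N) (hXJ : jordan_pair (P n) x X J) :
  (forall i : 'I_k, Kmx P n (x i) (submxrow X i) \in unitmx) /\
  (forall i : 'I_k, ('X - (x i)%:P) *: Wpoly P D n (x i) (submxrow X i)
                    = Wnum P D n (x i) (submxrow X i)) /\
  (forall Q : 'M[{poly R}]_p,
     lagrange_solution n x X F Q <->
     Q = \sum_(i < k) mpconst (F (x i)) *m Wpoly P D n (x i) (submxrow X i)).
Proof.
have [regP _] := hP; have [P0 _ _ _] := hD; have [injx _ _ _ freeX kerX] := hXJ.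
have unitK i : Kmx P n (x i) (submxrow X i) \in unitmx by exact: Kmx_unit.
split=> //; split=> [i|Q].
  by rewrite (WpolyE hD (kerX i)) (Wnum_kernel hD (kerX i)).
set S := \sum_i _.
have degS j : (n <= j)%N -> mpcoef S j = 0.
  move=> nj; rewrite mpcoef_sum big1 // => i _.
  rewrite mpcoefCM (WpolyE hD (kerX i)) /mpcoef map_mxN -/(mpcoef _ _).
  by rewrite mpcoefCM mpcoef_kernel // mulmx0 oppr0 mulmx0.
(* For i = j the factor V^T K(x_i, x_i) V is - K_i and cancels the inverse; for i != j it vanishes
   by orthogonality. *)
have WV i j : mpeval (Wpoly P D n (x i) (submxrow X i)) (x j) *m submxrow X j
    = if i == j then submxrow X j else 0.
  rewrite (WpolyE hD (kerX i)) /mpeval map_mxN -/(mpeval _ _) mpevalM mpevalC.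
  rewrite mpeval_kernel mulNmx -!mulmxA (mulmxA _^T).
  have [<- | ij] := eqVneq i j.
    by rewrite -[_^T *m _ *m _]opprK -/(Kmx _ _ _ _) mulmxN mulVmx // mulmxN mulmx1 opprK.
  rewrite (kernel_orthogonal hD _ (kerX j) (kerX i)) ?mulmx0 ?oppr0 //.
  by rewrite (inj_eq injx) eq_sym.
have evalS j : mpeval S (x j) *m submxrow X j = F (x j) *m submxrow X j.
  rewrite mpeval_sum mulmx_suml (bigD1 j) //= big1 => [|i ij].
    by rewrite mpevalM mpevalC -mulmxA WV eqxx addr0.
  by rewrite mpevalM mpevalC -mulmxA WV (negPf ij) mulmx0.
split=> [[/mpoly_ofP degQ evalQ] | ->]; last first.
  by split=> [|i j]; [apply/mpoly_ofP | rewrite !colE !mulmxA evalS].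
apply/eqP; rewrite -subr_eq0; apply/eqP.
(* The difference of two solutions solves the homogeneous problem. *)
apply: (lagrange_unique regP hD hn hXJ) => [j nj | i].
  by rewrite /mpcoef map_mxB -!/(mpcoef _ _) degQ // degS // subrr.
rewrite /mpeval map_mxB -!/(mpeval _ _) mulmxBl evalS.
apply/eqP; rewrite subr_eq0; apply/eqP/matrixP => s t.
have /matrixP/(_ s ord0) := evalQ i t.
by rewrite !colE !mulmxA -!colE ![col _ _ _ _]mxE.
Qed.
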